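(* Let $1\le r\le d$, let $\mathcal{E}$ be a convex set, let $Z:\mathcal{E}\to\mathrm{Herm}(d)$ and $M:\mathcal{E}\to GL(d,\mathbb{C})$ be two maps, and let $\varphi:\mathbb{R}^r\to\mathbb{R}$ be coordinatewise nondecreasing. For every $L\in\mathrm{Gr}(r,d)$ define $\Theta_L:\mathcal E\to\mathbb R$ by $$\Theta_L(z)=\Theta_{Z(z),\varphi}\bigl(M(z)^{-1}L\bigr),$$ and for $I=\{i_1<\cdots<i_r\}\subset[d]$ put $$\Lambda_I(z)=\varphi\bigl(\lambda_{i_1}^\uparrow(Z(z)),\dots,\lambda_{i_r}^\uparrow(Z(z))\bigr).$$ If $\Theta_L$ is concave on $\mathcal E$ for every $L\in\mathrm{Gr}(r,d)$, then for every Horn tuple $(I_1,\dots,I_n;K)$ of rank $r$ in dimension $d$, every probability distribution $\{\alpha_t:1\le t\le n\}$ and all $z_1,\dots,z_n\in\mathcal{E}$, $$\Lambda_K\Bigl(\sum_{t=1}^n\alpha_tz_t\Bigr)\ge\sum_{t=1}^n\alpha_t\Lambda_{I_t}(z_t).$$ If instead $\varphi$ is coordinatewise nonincreasing, then the same conclusion holds (again assuming $\Theta_L$ concave for every $L\in\mathrm{Gr}(r,d)$) with $\Lambda_I$ defined as $$\Lambda_I(z)=\varphi\bigl(\lambda_{j_1}^\uparrow(Z(z)),\dots,\lambda_{j_r}^\uparrow(Z(z))\bigr),\qquad I^\vee=\{j_1<\dots<j_r\}.$$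
   Context: $[d]=\{1,\dots,d\}$; $\mathrm{Herm}(d)$ is the set of $d\times d$ Hermitian matrices; $\mathrm{Gr}(r,d)$ is the set of $r$-dimensional subspaces of $\mathbb{C}^d$; $\lambda_1^\uparrow(A)\le\lambda_2^\uparrow(A)\le\cdots$ are the eigenvalues of a Hermitian matrix $A$ in increasing order. For $L\in\mathrm{Gr}(r,d)$ let $V_L:\mathbb{C}^r\to\mathbb{C}^d$ be an isometry with image $L$, $X_L=V_L^\dagger XV_L$, and $\Theta_{X,\varphi}(L)=\varphi(\lambda_1^\uparrow(X_L),\dots,\lambda_r^\uparrow(X_L))$. A function $\varphi:\mathbb{R}^r\to\mathbb{R}$ is coordinatewise nondecreasing (resp. nonincreasing) if $x_i\le y_i$ for all $i$ implies $\varphi(x)\le\varphi(y)$ (resp. $\varphi(x)\ge\varphi(y)$). For $I=\{i_1<\dots<i_r\}\subset[d]$, $I^\vee=\{d+1-i_r<\dots<d+1-i_1\}$. For a complete flag $E_\bullet=(E_1\subset\cdots\subset E_d=\mathbb{C}^d)$, $$\Omega_I(E_\bullet)=\{L\in\mathrm{Gr}(r,d):\dim(L\cap E_{i_q})\ge q\text{ for }q=1,\dots,r\}.$$ An $(n+1)$-tuple $(I_1,\dots,I_n;K)$ of $r$-subsets of $[d]$ is a Horn tuple of rank $r$ in dimension $d$ if $$\Omega_{I_1^\vee}(E_\bullet^{(1)})\cap\cdots\cap\Omega_{I_n^\vee}(E_\bullet^{(n)})\cap\Omega_K(G_\bullet)\ne\varnothing$$ for every choice of complete flags $E_\bullet^{(1)},\dots,E_\bullet^{(n)},G_\bullet$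 in $\mathbb{C}^d$. *)

(* Defs.v *)
(* The complex numbers are R[i] with R : realType. *)
From HB Require Import structures.
From mathcomp Require Import all_boot all_order all_algebra.
From mathcomp Require Import sesquilinear spectral.
From mathcomp Require Import complex.
From mathcomp Require Import boolp classical_sets reals convex.

Set Implicit Arguments.
Unset Strict Implicit.
Unset Printing Implicit Defensive.

Import Order.TTheory GRing.Theory Num.Theory.
Local Open Scope classical_set_scope.
Local Open Scope ring_scope.
Local Open Scope sesquilinear_scope.

(* All indices are 0-based: 'I_d stands for [d], and the k-th smallest
   eigenvalue, the q-th element of I, etc. are counted from k, q = 0. *)

Section Eigenvalues.
Context {R : realType} {n : nat}.
Implicit Type A : 'M[R[i]]_n.

(* Roots of the characteristic polynomial, with multiplicity. *)
Definition eigenvalues A : seq R[i] :=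
  sval (closed_field_poly_normal (char_poly A)).

(* Meaningful for Hermitian A, whose eigenvalues equal their real parts. *)
Definition eig_up A (k : nat) : R :=
  nth 0 (sort <=%R [seq complex.Re x | x <- eigenvalues A]) k.

End Eigenvalues.

Section IndexSets.
Context {d : nat}.
Implicit Type I : {set 'I_d}.

(* [enum I] lists I in increasing order, so this is i_(q+1) - 1 when
   I = {i_1 < ... < i_r} is read in {1, ..., d}. *)
Definition elt I (q : nat) : nat := nth 0%N [seq val i | i <- enum I] q.

(* rev_ord i = d - 1 - i is i |-> d + 1 - i in 0-based indexing. *)
Definition dualset I : {set 'I_d} := [set rev_ord i | i in I].

End IndexSets.

Section Compression.
Context {R : realType} {d : nat}.
Local Notation C := R[i].
Implicit Type L : {vspace 'cV[C]_d}.

Definition isometry_onto r L : set 'M[C]_(d, r) :=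
  [set V | V^t* *m V = 1%:M /\ limg (linfun (mulmx V : 'cV_r -> 'cV_d)) = L].
Arguments isometry_onto r L : clear implicits.

(* A chosen V_L; see [isom_ofP] for existence and [eig_up_compress] for the
   independence of the spectrum of V_L^t* X V_L from the choice. *)
Definition isom_of r L : 'M[C]_(d, r) := xget 0 (isometry_onto r L).

Definition compress r (X : 'M[C]_d) L : 'M[C]_r :=
  (isom_of r L)^t* *m X *m isom_of r L.

Definition Theta r (X : 'M[C]_d) (phi : 'rV[R]_r -> R) L : R :=
  phi (\row_(q < r) eig_up (compress r X L) q).

Definition mximage (A : 'M[C]_d) L : {vspace 'cV[C]_d} :=
  (linfun (mulmx A : 'cV_d -> 'cV_d) @: L)%VS.

Lemma isom_ofP r L : \dim L = r -> isometry_onto r L (isom_of r L).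
Proof.
move=> dimL; apply: xgetPex; case: _ / dimL.
pose A : 'M[C]_(\dim L, d) := \matrix_q ((vbasis L)`_q)^T.
have rowA (u : 'rV_(\dim L)) :
    (u *m A)^T = \sum_(q < \dim L) u 0 q *: (vbasis L)`_q.
  rewrite mulmx_sum_row linear_sum; apply: eq_bigr => q _.
  by rewrite linearZ /= rowK trmxK.
have freeA : row_free A.
  rewrite -kermx_eq0; apply/eqP/row_matrixP => k; rewrite row0.
  have /(congr1 trmx) : row k (kermx A) *m A = 0.
    by rewrite -row_mul mulmx_ker row0.
  rewrite rowA trmx0 => ker0; apply/rowP => q; rewrite [RHS]mxE.
  by have /freeP/(_ _ ker0 q) := basis_free (vbasisP L).
have ledim : (\dim L <= d)%N by rewrite -(eqP freeA) rank_leq_col.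
pose S := schmidt A; have SU : S \is unitarymx by exact: schmidt_unitarymx.
have V1 : (S^T)^t* *m S^T = 1%:M.
  move/unitarymxP: SU => /(congr1 trmx).
  by rewrite trmx_mul trmx1 map_trmx trmxK.
exists S^T; split=> //; apply/eqP; rewrite eqEdim; apply/andP; split.
  apply/subvP => _ /memv_imgP[u _ ->]; rewrite lfunE /=.
  have /submxP[D SA] : (u^T *m S <= A)%MS.
    by rewrite (submx_trans (submxMl _ _)) // (eqmx_schmidt_free freeA).
  rewrite -[u in _ *m u]trmxK -trmx_mul SA rowA.
  apply: memv_suml => q _; apply: memvZ.
  by apply: vbasis_mem; apply: mem_nth; rewrite size_tuple.
rewrite limg_dim_eq; first by rewrite dimvf /dim /= muln1.
apply/eqP; rewrite capfv; apply/lker0P => x y; rewrite !lfunE /= => xy.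
by rewrite -[x]mul1mx -[y]mul1mx -V1 -!mulmxA xy.
Qed.

Lemma eig_up_compress r (X : 'M[C]_d) L (V : 'M[C]_(d, r)) k :
  isometry_onto r L V -> eig_up (V^t* *m X *m V) k = eig_up (compress r X L) k.
Proof.
move=> isoV; have := xgetPex 0 (ex_intro _ V isoV).
rewrite -/(isom_of r L) /compress; move: (isom_of r L) => W [W1 imW].
case: isoV => V1 imV.
have WV : W *m (W^t* *m V) = V.
  apply/matrixP => i j.
  have : col j V \in limg (linfun (mulmx W : 'cV_r -> 'cV_d)).
    rewrite imW -imV colE.
    have -> : V *m delta_mx j 0 =
        linfun (mulmx V : 'cV_r -> 'cV_d) (delta_mx j 0) by rewrite lfunE.
    exact: memv_img (memvf _).
  case/memv_imgP => x _; rewrite lfunE /= => colV.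
  have : col j (W *m (W^t* *m V)) = col j V.
    by rewrite [LHS]colE -!mulmxA -colE colV (mulmxA (W^t*)) W1 mul1mx.
  by move/colP/(_ i); rewrite !mxE.
pose U := W^t* *m V.
have Vt : V^t* = U^t* *m W^t*.
  by rewrite -{1}WV trmx_mul map_mxM.
have U1 : U^t* *m U = 1%:M.
  by rewrite -V1 [in RHS]Vt -mulmxA.
have -> : V^t* *m X *m V = U^t* *m (W^t* *m X *m W) *m U.
  by rewrite Vt -{1}WV !mulmxA.
move: (W^t* *m X *m W) => A; rewrite /eig_up /eigenvalues.
suff -> : char_poly (U^t* *m A *m U) = char_poly A by [].
move: U1; move: (U^t*) => U' U1.
have cpE : char_poly_mx (U' *m A *m U) =
    map_mx polyC U' *m char_poly_mx A *m map_mx polyC U.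
  rewrite /char_poly_mx mulmxBr mulmxBl scalar_mxC -(mulmxA 'X%:M).
  by rewrite -!map_mxM U1 map_mx1 mulmx1.
rewrite /char_poly cpE !det_mulmx mulrAC -det_mulmx -map_mxM U1.
by rewrite map_mx1 det1 mul1r.
Qed.

End Compression.

Section Schubert.
Context {R : realType} {d : nat}.
Local Notation C := R[i].

(* E_k is [E k] for 0 <= k <= d (with E_0 = 0); [E k] is irrelevant for k > d. *)
Definition complete_flag (E : nat -> {vspace 'cV[C]_d}) : Prop :=
  (forall k, (k <= d)%N -> \dim (E k) = k) /\
  (forall k, (k < d)%N -> (E k <= E k.+1)%VS).

Definition schubert r (I : {set 'I_d}) (E : nat -> {vspace 'cV[C]_d}) :
    set {vspace 'cV[C]_d} :=
  [set L | \dim L = r /\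
    forall q : 'I_r, (q.+1 <= \dim (L :&: E (elt I q).+1)%VS)%N].

End Schubert.

Definition horn_tuple (R : realType) (r d n : nat)
    (I : 'I_n -> {set 'I_d}) (K : {set 'I_d}) : Prop :=
  [/\ forall t, #|I t| = r, #|K| = r &
   forall (E : 'I_n -> nat -> {vspace 'cV[R[i]]_d})
          (G : nat -> {vspace 'cV[R[i]]_d}),
     (forall t, complete_flag (E t)) -> complete_flag G ->
     (\bigcap_(t in [set: 'I_n]) schubert r (dualset (I t)) (E t))
       `&` schubert r K G !=set0].

Definition coord_nondecreasing (R : realType) r (phi : 'rV[R]_r -> R) : Prop :=
  forall x y : 'rV[R]_r, (forall i, x 0 i <= y 0 i) -> phi x <= phi y.

Definition coord_nonincreasing (R : realType) r (phi : 'rV[R]_r -> R) : Prop :=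
  forall x y : 'rV[R]_r, (forall i, x 0 i <= y 0 i) -> phi y <= phi x.

Definition concave_function (R : realType) (V : lmodType R)
    (E : set (convex_lmodType V)) (f : V -> R) : Prop :=
  convex_function E (fun z => - f z : R^o).

Section Functions.
Context {R : realType} {d r : nat} {V : Type}.
Variables (phi : 'rV[R]_r -> R) (Z M : V -> 'M[R[i]]_d).

Definition ThetaL (L : {vspace 'cV[R[i]]_d}) (z : V) : R :=
  Theta (Z z) phi (mximage (invmx (M z)) L).

Definition Lambda (I : {set 'I_d}) (z : V) : R :=
  phi (\row_(q < r) eig_up (Z z) (elt I q)).

End Functions.

(* Main.v *)
(* Choose flags adapted to the eigenbases of [Z (z_t)] (eigenvalues decreasing)
   and of [Z] at the barycenter (eigenvalues increasing), and transport them by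
   the respective [M].  The Horn condition yields one [L] lying in all the
   Schubert varieties; pulling back by [M^-1], Courant-Fischer bounds each
   eigenvalue of the compressions on the side that monotonicity of [phi] needs,
   so [Theta_L z_t >= Lambda_(I_t) z_t] and [Theta_L <= Lambda_K] at the
   barycenter, and Jensen's inequality for [Theta_L] concludes.  In the
   nonincreasing case the two kinds of flags are exchanged. *)
Require Import Defs.
From mathcomp Require Import all_boot all_order all_algebra.
From mathcomp Require Import sesquilinear spectral complex.
From mathcomp Require Import boolp classical_sets reals convex.
From mathcomp Require Import perm ring.

Set Implicit Arguments.
Unset Strict Implicit.
Unset Printing Implicit Defensive.

Import Order.TTheory GRing.Theory Num.Theory.
Local Open Scope classical_set_scope.
Local Open Scope ring_scope.
Local Open Scope sesquilinear_scope.

(** [P] intertwines the characteristic matrices as well, and its determinant, a nonzero constant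
    polynomial, cancels. *)
Lemma char_poly_similar (F : fieldType) n (P A B : 'M[F]_n) :
  P \in unitmx -> P *m A = B *m P -> char_poly A = char_poly B.
Proof.
move=> Pu PA; rewrite /char_poly.
have detP : \det (map_mx polyC P) != 0.
  by rewrite det_map_mx polyC_eq0 -unitfE -unitmxE.
apply: (mulfI detP); rewrite [RHS]mulrC -!det_mulmx; congr (\det _).
by rewrite mulmxBr mulmxBl scalar_mxC -!map_mxM PA.
Qed.

(** * Unitary diagonalization with the eigenvalues in a prescribed order *)

Section SpectralTheorem.
Context {R : realType} {d : nat}.
Local Notation C := R[i].
Implicit Type X : 'M[C]_d.

(** Both lists split the characteristic polynomial into linear factors, and such a factorization is
    unique up to order. *)
Lemma perm_eigenvalues_spectral X : X \is normalmx ->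
  perm_eq (eigenvalues X) [seq spectral_diag X 0 i | i <- enum 'I_d].
Proof.
move=> /orthomx_spectralP.
set P := spectralmx X; set D := spectral_diag X => XE.
rewrite /eigenvalues; case: closed_field_poly_normal => s /=.
rewrite (monicP (char_poly_monic X)) scale1r => sE.
have Pu : P \in unitmx := spectral_unit X.
apply: prod_XsubC_eq; rewrite -sE big_map big_enum /=.
have PX : P *m X = diag_mx D *m P by rewrite {1}XE !mulmxA mulmxV // mul1mx.
rewrite (char_poly_similar Pu PX) (char_poly_trig (diag_mx_is_trig _)).
by apply: eq_bigr => i _; rewrite mxE eqxx mulr1n.
Qed.

(** [spectral_diag] comes in no particular order; its entries are real, so taking real parts and
    sorting only permutes them. *)
Lemma spectral_eig_up X : X \is hermsymmx ->
  exists p : 'S_d, forall k : 'I_d, (eig_up X k)%:C%C = spectral_diag X 0 (p k).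
Proof.
move=> hX; have := perm_eigenvalues_spectral (hermitian_normalmx hX).
move/(perm_map (@complex.Re R)); rewrite -map_comp => pe.
pose t := [tuple complex.Re (spectral_diag X 0 i) | i < d].
have /tuple_permP[p sE] :
    perm_eq (sort <=%R [seq complex.Re x | x <- eigenvalues X]) t.
  by rewrite perm_sort.
exists p => k; rewrite /eig_up sE -[LHS]/((_`_k)%:C%C) -tnth_nth.
rewrite !tnth_map !tnth_ord_tuple.
by rewrite RRe_real //; exact: mxOverP (hermitian_spectral_diag_real hX) _ _.
Qed.

Lemma size_eigenvalues X : size (eigenvalues X) = d.
Proof.
rewrite /eigenvalues; case: closed_field_poly_normal => s /=.
rewrite (monicP (char_poly_monic X)) scale1r => /(congr1 (size \o polyseq)) /=.
by rewrite size_prod_XsubC size_char_poly => -[].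
Qed.

Lemma eig_up_homo X i j : (i <= j < d)%N -> eig_up X i <= eig_up X j.
Proof.
case/andP=> ij jd; apply: le_sorted_leq_nth => //; first exact: sort_le_sorted.
  by rewrite inE size_sort size_map size_eigenvalues (leq_ltn_trans ij).
by rewrite inE size_sort size_map size_eigenvalues.
Qed.

Lemma hermitian_diagonalization X (s : 'S_d) : X \is hermsymmx ->
  exists2 U : 'M[C]_d, U^t* *m U = 1%:M &
    X = U *m diag_mx (\row_k (eig_up X (s k))%:C%C) *m U^t*.
Proof.
move=> hX; have [p pE] := spectral_eig_up hX.
have XE := orthomx_spectralP (hermitian_normalmx hX).
move: XE; rewrite (invmx_unitary (spectral_unitarymx X)).
have := unitarymxP (spectral_unitarymx X).
set P := spectralmx X => P1 XE.
(* Permutations compose left to right: [t k = p (s k)], the position in [spectral_diag X] of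
   [eig_up X (s k)]. *)
pose t := (s * p)%g.
exists ((row_perm t P)^t*).
  apply/matrixP => i j; move/matrixP/(_ (t i) (t j)): P1.
  rewrite !mxE (inj_eq perm_inj) => <-; apply: eq_bigr => k _.
  by rewrite !mxE conjCK.
rewrite {1}XE; apply/matrixP => i j; rewrite !mul_mx_diag !mxE.
rewrite (reindex_inj (@perm_inj _ t)) /=.
by apply: eq_bigr => k _; rewrite !mxE pE permM conjCK.
Qed.

End SpectralTheorem.

(** * Complete flags: transport by invertible matrices, and the standard flag *)

Section Flags.
Context {R : realType} {d : nat}.
Local Notation C := R[i].
Implicit Types (S : {vspace 'cV[C]_d}) (F : nat -> {vspace 'cV[C]_d}).

Lemma dim_mximage (A : 'M[C]_d) S : A \in unitmx -> \dim (mximage A S) = \dim S.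
Proof.
move=> Au; apply: limg_dim_eq; apply/eqP; rewrite -subv0; apply/subvP => v.
rewrite memv_cap memv_ker lfunE /= memv0 => /andP[_ /eqP].
move/(congr1 (mulmx (invmx A))).
by rewrite mulmxA mulVmx // mul1mx mulmx0 => ->.
Qed.

Lemma mximageK (A : 'M[C]_d) S : A \in unitmx ->
  mximage (invmx A) (mximage A S) = S.
Proof.
move=> Au; rewrite /mximage -limg_comp -[RHS]lim1g; congr (_ @: _)%VS.
apply/lfunP => v; rewrite comp_lfunE id_lfunE !lfunE /=.
by rewrite mulmxA mulVmx // mul1mx.
Qed.

Lemma complete_flag_mximage (A : 'M[C]_d) F : A \in unitmx ->
  complete_flag F -> complete_flag (fun k => mximage A (F k)).
Proof.
move=> Au [dimF leF]; split=> k kd; first by rewrite dim_mximage ?dimF.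
exact: limgS (leF _ kd).
Qed.

Definition coord_space k : {vspace 'cV[C]_d} :=
  <<[seq delta_mx i 0%R | i <- take k (enum 'I_d)]>>%VS.

Lemma complete_flag_coord_space : complete_flag coord_space.
Proof.
have fr : free [seq delta_mx i 0 : 'cV[C]_d | i <- enum 'I_d].
  pose t := [tuple delta_mx i 0 : 'cV[C]_d | i < d].
  have tE (i : 'I_d) : t`_i = delta_mx i 0 by rewrite -tnth_nth tnth_mktuple.
  apply/(@freeP _ _ _ t) => c c0 i.
  move/colP/(_ i): c0; rewrite summxE mxE (bigD1 i) // big1 => [|j ji].
    by rewrite tE /= addr0 !mxE !eqxx mulr1.
  by rewrite tE !mxE eq_sym (negPf ji) mulr0.
split=> k kd; last first.
  rewrite /coord_space (take_nth (Ordinal kd)) ?size_enum_ord //.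
  by rewrite map_rcons -cats1 span_cat addvSl.
have -> : k = size [seq delta_mx i 0 : 'cV[C]_d | i <- take k (enum 'I_d)].
  by rewrite size_map size_take size_enum_ord; case: ltngtP kd.
rewrite {1}size_map size_takel ?size_enum_ord //.
(* A list is free by definition when its span has dimension its length; a prefix of a free list is
   free. *)
apply/eqP; rewrite -[_ == _]/(free _).
by move: fr; rewrite -{1}(cat_take_drop k (enum 'I_d)) map_cat => /catl_free.
Qed.

Lemma coord_spaceP k (v : 'cV[C]_d) (i : 'I_d) :
  v \in coord_space k -> (k <= i)%N -> v i 0 = 0.
Proof.
rewrite /coord_space; set s := map _ _ => vs ki.
have vE := @coord_span _ _ _ (in_tuple s) v vs.
rewrite vE summxE big1 // => j _.
have js : (j < size (take k (enum 'I_d)))%N.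
  by rewrite -(size_map (delta_mx^~ 0 : _ -> 'cV[C]_d)).
rewrite mxE /= (nth_map i) // mxE; set l := nth _ _ _.
suff : (l < k)%N by case: (i =P l) => [<-|]; rewrite ?mulr0 // ltnNge ki.
have : l \in take k (enum 'I_d) by exact: mem_nth.
move/(map_f val); rewrite map_take val_enum_ord take_iota mem_iota add0n.
by rewrite leq_min => /and3P[].
Qed.

End Flags.

(* [hform 1%:M v] is the squared norm of [v]; both sides of the eigenvalue
   estimates are real, but compared in the partial order of R[i]. *)
Definition hform (R : realType) n (X : 'M[R[i]]_n) (v : 'cV_n) : R[i] :=
  (v^t* *m X *m v) 0 0.

(** * Hermitian forms, eigenflags and the Courant-Fischer bounds *)

Section HermitianForm.
Context {R : realType}.
Local Notation C := R[i].

Lemma hform_mulmx n m (X : 'M[C]_n) (U : 'M[C]_(n, m)) (w : 'cV_m) :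
  hform X (U *m w) = hform (U^t* *m X *m U) w.
Proof. by rewrite /hform trmx_mul map_mxM !mulmxA. Qed.

Lemma hform_diag n (D : 'rV[C]_n) (w : 'cV_n) :
  hform (diag_mx D) w = \sum_i D 0 i * `|w i 0| ^+ 2.
Proof.
rewrite /hform mul_mx_diag mxE; apply: eq_bigr => i _.
by rewrite !mxE mulrAC normCKC [RHS]mulrC.
Qed.

Lemma hform1E n (w : 'cV[C]_n) : hform 1%:M w = \sum_i `|w i 0| ^+ 2.
Proof.
rewrite -diag_const_mx hform_diag.
by apply: eq_bigr => i _; rewrite mxE mul1r.
Qed.

Lemma hform1_gt0 n (w : 'cV[C]_n) : w != 0 -> 0 < hform 1%:M w.
Proof.
have sq_ge0 (i : 'I_n) : true -> 0 <= `|w i 0| ^+ 2 by rewrite exprn_ge0.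
move=> w0; rewrite hform1E lt_neqAle sumr_ge0 // andbT.
apply: contra w0; rewrite eq_sym psumr_eq0 // => /allP w0.
apply/eqP/colP => i; rewrite mxE; apply/eqP; have := w0 i (mem_index_enum _).
by rewrite sqrf_eq0 normr_eq0.
Qed.

Context {d : nat}.
Implicit Types X : 'M[C]_d.

(* [w] is the vector of coordinates of [v] in an orthonormal eigenbasis of [X]
   whose k-th member has eigenvalue [eig_up X (s k)]. *)
Lemma hermitian_flag X (s : 'S_d) : X \is hermsymmx ->
  exists2 F : nat -> {vspace 'cV[C]_d}, complete_flag F &
    forall k v, v \in F k -> exists2 w : 'cV[C]_d,
      forall i : 'I_d, (k <= i)%N -> w i 0 = 0 &
      hform 1%:M v = \sum_i `|w i 0| ^+ 2 /\
      hform X v = \sum_i (eig_up X (s i))%:C%C * `|w i 0| ^+ 2.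
Proof.
move=> hX; have [U U1 XE] := hermitian_diagonalization s hX.
have /mulmx1_unit[_ Uu] := U1.
exists (fun k => mximage U (coord_space k)).
  exact: complete_flag_mximage Uu complete_flag_coord_space.
move=> k _ /memv_imgP[w wk ->]; exists w => [i|]; first exact: coord_spaceP.
rewrite lfunE /= !hform_mulmx mulmx1 U1 hform1E; split=> //.
have -> : U^t* *m X *m U = diag_mx (\row_k (eig_up X (s k))%:C%C).
  by rewrite {1}XE -!mulmxA U1 mulmx1 mulmxA U1 mul1mx.
rewrite hform_diag.
by apply: eq_bigr => i _; rewrite mxE.
Qed.

Definition increasing_eigenflag X (F : nat -> {vspace 'cV[C]_d}) :=
  complete_flag F /\
  forall k v, (k < d)%N -> v \in F k.+1 ->
    hform X v <= (eig_up X k)%:C%C * hform 1%:M v.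

(** The model is the span of eigenvectors for the [k.+1] largest eigenvalues, the least of which has
    0-based index [d - k.+1]. Only the Rayleigh quotient bound is recorded. *)
Definition decreasing_eigenflag X (F : nat -> {vspace 'cV[C]_d}) :=
  complete_flag F /\
  forall k v, (k < d)%N -> v \in F k.+1 ->
    (eig_up X (d - k.+1))%:C%C * hform 1%:M v <= hform X v.

(** In eigenbasis coordinates, a vector of [F k.+1] is supported on indices [i <= k], so the bound
    holds term by term. *)
Lemma exists_increasing_eigenflag X :
  X \is hermsymmx -> exists F, increasing_eigenflag X F.
Proof.
move=> /(hermitian_flag 1%g)[F cF FP];
exists F; split=> // k v kd /FP[w w0 [-> ->]].
rewrite mulr_sumr; apply: ler_sum => i _; rewrite perm1.
have [ik|/w0 ->] := leqP i k; last by rewrite normr0 expr0n !mulr0.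
by rewrite ler_wpM2r ?exprn_ge0 // lecR eig_up_homo // ik.
Qed.

Lemma exists_decreasing_eigenflag X :
  X \is hermsymmx -> exists F, decreasing_eigenflag X F.
Proof.
move=> /(hermitian_flag (perm rev_ord_inj))[F cF FP].
exists F; split=> // k v kd /FP[w w0 [-> ->]].
rewrite mulr_sumr; apply: ler_sum => i _; rewrite permE /=.
have [ik|/w0 ->] := leqP i k; last by rewrite normr0 expr0n !mulr0.
rewrite ler_wpM2r ?exprn_ge0 // lecR eig_up_homo // leq_sub2l //=.
by rewrite ltn_subrL /= (leq_ltn_trans _ kd).
Qed.

Lemma dimv_cV_le (S : {vspace 'cV[C]_d}) : (\dim S <= d)%N.
Proof. by rewrite (leq_trans (dimvS (subvf S))) // dimvf /dim /= muln1. Qed.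

Lemma capv_neq0 (S T : {vspace 'cV[C]_d}) : (d < \dim S + \dim T)%N ->
  exists v, [/\ v \in S, v \in T & v != 0].
Proof.
rewrite -dimv_sum_cap => dST; exists (vpick (S :&: T)%VS).
have /andP[-> ->] : (vpick (S :&: T)%VS \in S) && (vpick (S :&: T)%VS \in T).
  by rewrite -memv_cap memv_pick.
split=> //; rewrite vpick0 -dimv_eq0 -lt0n.
rewrite -(ltn_add2l (\dim (S + T))) addn0.
exact: leq_ltn_trans (dimv_cV_le _) dST.
Qed.

(** [S] meets the [(d - k)]-dimensional step of a decreasing eigenflag in a nonzero vector, whose
    Rayleigh quotient lies between [eig_up X k] and [c]. *)
Lemma eig_up_le_subspace X (S : {vspace 'cV[C]_d}) k c :
  X \is hermsymmx -> (k < \dim S)%N ->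
  (forall v, v \in S -> hform X v <= c%:C%C * hform 1%:M v) -> eig_up X k <= c.
Proof.
move=> hX kS Sc; have [F [[dimF _] FP]] := exists_decreasing_eigenflag hX.
have kd := leq_trans kS (dimv_cV_le S).
have [|v [vS vF v0]] := @capv_neq0 S (F (d - k)%N).
  by rewrite dimF ?leq_subr // -{1}(subnKC (ltnW kd)) ltn_add2r.
move: vF; rewrite -subnSK // => /FP; rewrite subnSK // subKn ?(ltnW kd) //.
rewrite leq_subr => /(_ isT) Xv.
by have := le_trans Xv (Sc v vS); rewrite ler_pM2r ?hform1_gt0 // lecR.
Qed.

(** The mirror argument: [S] meets the [k.+1]-dimensional step of an increasing eigenflag. *)
Lemma eig_up_ge_subspace X (S : {vspace 'cV[C]_d}) k c :
  X \is hermsymmx -> (k < d)%N -> (d - k <= \dim S)%N ->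
  (forall v, v \in S -> c%:C%C * hform 1%:M v <= hform X v) -> c <= eig_up X k.
Proof.
move=> hX kd kS Sc; have [F [[dimF _] FP]] := exists_increasing_eigenflag hX.
have [|v [vS vF v0]] := @capv_neq0 S (F k.+1).
  by rewrite dimF // addnS ltnS addnC -leq_subLR.
have := le_trans (Sc v vS) (FP _ _ kd vF).
by rewrite ler_pM2r ?hform1_gt0 // lecR.
Qed.

End HermitianForm.

(** * Order and duality of index sets *)

Section IndexSets.
Context {d : nat}.
Implicit Type I : {set 'I_d}.

Lemma elt_lt I q : (q < #|I|)%N -> (elt I q < d)%N.
Proof.
rewrite cardE => qI.
have /mapP[i _ ->] : elt I q \in [seq val i | i <- enum I].
  by rewrite mem_nth // size_map.
exact: ltn_ord.
Qed.

Lemma dualsetK : involutive (@dualset d).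
Proof.
by move=> I; rewrite /dualset -imset_comp (eq_imset _ rev_ordK) imset_id.
Qed.

Lemma card_dualset I : #|dualset I| = #|I|.
Proof. exact: card_imset rev_ord_inj. Qed.

Lemma sorted_enum I : sorted (relpre val ltn) (enum I).
Proof.
rewrite -sorted_map; apply: (subseq_sorted ltn_trans _ (iota_ltn_sorted 0 d)).
by rewrite -val_enum_ord map_subseq // enumT [enum I]/enum_mem filter_subseq.
Qed.

Lemma enum_dualset I : enum (dualset I) = rev [seq rev_ord i | i <- enum I].
Proof.
apply: (@irr_sorted_eq _ (relpre val ltn)) => [||||i].
- by move=> i j k /=; exact: ltn_trans.
- by move=> i /=; exact: ltnn.
- exact: sorted_enum.
- rewrite rev_sorted sorted_map; apply: sub_sorted (sorted_enum I) => i j /= ij.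
  by rewrite ltn_sub2l // (leq_trans _ (ltn_ord j)).
- rewrite mem_enum mem_rev; apply/imsetP/mapP => -[j Ij ->]; exists j => //.
    by rewrite mem_enum.
  by rewrite -mem_enum.
Qed.

Lemma elt_dualset I q : (q < #|I|)%N ->
  elt (dualset I) q = (d - (elt I (#|I| - q.+1)).+1)%N.
Proof.
move=> qI; pose i0 := Ordinal (elt_lt qI).
have qs : (q < size (enum I))%N by rewrite -cardE.
rewrite cardE; have qI' : (size (enum I) - q.+1 < size (enum I))%N.
  by rewrite ltn_subrL (leq_ltn_trans _ qs).
rewrite /elt enum_dualset map_rev nth_rev !size_map //.
by rewrite -map_comp !(nth_map i0).
Qed.

End IndexSets.

(** * Compressions and Schubert varieties *)

Section Schubert.
Context {R : realType} {d r : nat}.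
Local Notation C := R[i].
Implicit Types (X : 'M[C]_d) (I : {set 'I_d}).
Implicit Types (L S : {vspace 'cV[C]_d}) (F : nat -> {vspace 'cV[C]_d}).

Lemma compress_hermitian X L : X \is hermsymmx -> compress r X L \is hermsymmx.
Proof.
move=> /is_hermitianmxP; rewrite expr0 scale1r => XE; apply/is_hermitianmxP.
rewrite expr0 scale1r /compress !trmx_mul !map_mxM.
rewrite [in LHS]XE -mulmxA; congr (_ *m (_ *m _)).
by apply/matrixP => i j; rewrite !mxE; symmetry; exact: conjCK.
Qed.

(** [T] is the preimage of [L :&: S] under the chosen isometry, which maps it onto [L :&: S] and
    preserves both forms. *)
Lemma compress_preim X L S : \dim L = r ->
  exists2 T : {vspace 'cV[C]_r}, (\dim (L :&: S) <= \dim T)%N &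
    forall w, w \in T -> exists2 v, v \in S &
       hform (compress r X L) w = hform X v /\ hform 1%:M w = hform 1%:M v.
Proof.
move=> /isom_ofP; rewrite /isometry_onto /compress.
move: (isom_of r L) => W [W1 imW].
pose f := linfun (mulmx W : 'cV_r -> 'cV_d).
exists (f @^-1: (L :&: S))%VS => [|w].
  rewrite -{1}(@lpreimK _ _ _ f (L :&: S)) ?imW ?capvSl //.
  by rewrite -(limg_ker_dim f (f @^-1: _)) leq_addl.
rewrite -memv_preim memv_cap lfunE /= => /andP[_ WS]; exists (W *m w) => //.
by rewrite !hform_mulmx mulmx1 W1.
Qed.

Lemma schubert_mximage (A : 'M[C]_d) I F L : A \in unitmx ->
  schubert r I (fun k => mximage A (F k)) L ->
  schubert r I F (mximage (invmx A) L).
Proof.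
move=> Au [dimL LF]; split; first by rewrite dim_mximage ?unitmx_inv.
move=> q; apply: leq_trans (LF q) _.
rewrite -(@dim_mximage _ _ (invmx A)) ?unitmx_inv //; apply: dimvS.
rewrite subv_cap; apply/andP; split; first exact: limgS (capvSl _ _).
by rewrite -[X in (_ <= X)%VS](mximageK _ Au); exact: limgS (capvSr _ _).
Qed.

End Schubert.

(** * Eigenvalue bounds for compressions to Schubert varieties *)

Section CompressionBounds.
Context {R : realType} {d r : nat}.
Local Notation C := R[i].
Implicit Types (X : 'M[C]_d) (I : {set 'I_d}).
Implicit Types (L : {vspace 'cV[C]_d}) (F : nat -> {vspace 'cV[C]_d}).

Lemma eig_up_compress_le_schubert X I F L (q : 'I_r) :
  X \is hermsymmx -> #|I| = r ->
  increasing_eigenflag X F ->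
  schubert r I F L -> eig_up (compress r X L) q <= eig_up X (elt I q).
Proof.
move=> hX cI [_ FP] [dimL /(_ q) LF].
have [T dimT TP] := compress_preim X (F (elt I q).+1) dimL.
apply: (eig_up_le_subspace (compress_hermitian L hX) (leq_trans LF dimT)).
by move=> w /TP[v vF [-> ->]]; apply: FP => //; rewrite elt_lt // cI.
Qed.

Lemma eig_up_compress_ge_schubert X I F L (q : 'I_r) :
  X \is hermsymmx -> #|I| = r ->
  decreasing_eigenflag X F ->
  schubert r (dualset I) F L -> eig_up X (elt I q) <= eig_up (compress r X L) q.
Proof.
move=> hX cI [_ FP] [dimL /(_ (rev_ord q)) LF].
have [T dimT TP] := compress_preim X (F (elt (dualset I) (rev_ord q)).+1) dimL.
apply: (eig_up_ge_subspace (compress_hermitian L hX) (ltn_ord q)).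
  by apply: leq_trans dimT; rewrite -(subnSK (ltn_ord q)).
have eltq : elt I q = (d - (elt (dualset I) (rev_ord q)).+1)%N.
  by rewrite -[in LHS](dualsetK I) elt_dualset card_dualset cI.
move=> w /TP[v vF [-> ->]]; rewrite eltq; apply: FP => //.
by rewrite elt_lt // card_dualset cI.
Qed.

End CompressionBounds.

(** * Jensen's inequality for concave functions *)

Section Jensen.
Context {R : realType} {V : lmodType R}.
Variables (E : set V) (f : V -> R).
Hypotheses (cE : convex_set E) (cf : concave_function E f).

Lemma concave_two_points x y (t : R) : E x -> E y -> 0 <= t <= 1 ->
  E (t *: x + (1 - t) *: y) /\
  t * f x + (1 - t) * f y <= f (t *: x + (1 - t) *: y).
Proof.
move=> /mem_set Ex /mem_set Ey /andP[t0 t1]; split.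
  exact: set_mem (cE (interval_inference.Itv01 t0 t1) Ex Ey).
have := cf (interval_inference.Itv01 t0 t1) Ex Ey.
by rewrite convRE /= !mulrN -opprD lerN2.
Qed.

(* Jensen's inequality for unnormalized weights, so that the induction on [n]
   needs no rescaling of the first weights. *)
Lemma concave_weighted_sum n (a : 'I_n -> R) (z : 'I_n -> V) :
  (forall t, 0 <= a t) -> (forall t, E (z t)) -> 0 < \sum_t a t ->
  E ((\sum_t a t)^-1 *: (\sum_t a t *: z t)) /\
  \sum_t a t * f (z t) <=
    (\sum_t a t) * f ((\sum_t a t)^-1 *: (\sum_t a t *: z t)).
Proof.
elim: n a z => [|n IH] a z a0 Ez; first by rewrite big_ord0 ltxx.
rewrite !big_ord_recr /=; set s := \sum_(i < n) _; set b := a ord_max => sb_gt0.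
have s_ge0 : 0 <= s by apply: sumr_ge0 => i _.
(* If the first weights sum to zero, they all vanish and only the last point remains. *)
have [s0|s_neq0] := eqVneq s 0.
  have a_eq0 (i : 'I_n) : a (widen_ord (leqnSn n) i) = 0.
    move: s0 => /eqP; rewrite psumr_eq0 // => /allP.
    by move/(_ i (mem_index_enum _))/eqP.
  move: sb_gt0; rewrite s0 !big1 => [|i _|i _].
  2,3: by rewrite a_eq0 ?scale0r ?mul0r.
  rewrite !add0r => b_gt0; rewrite scalerA mulVf ?gt_eqF // scale1r.
  by split; [exact: Ez|].
have s_gt0 : 0 < s by rewrite lt0r s_neq0.
have [Ew le_w] :=
  IH _ _ (fun i => a0 _) (fun i => Ez (widen_ord (leqnSn n) i)) s_gt0.
move: Ew le_w; rewrite -/s; set w := s^-1 *: _ => Ew le_w.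
(* The full barycenter divides the segment from the partial barycenter [w] to the last point with
   weights [s / (s + b)] and [b / (s + b)]. *)
have t01 : 0 <= s / (s + b) <= 1.
  by rewrite divr_ge0 ?(ltW sb_gt0) //= ler_pdivrMr // mul1r lerDl a0.
have [] := concave_two_points Ew (Ez ord_max) t01.
have sb_neq0 : s + b != 0 by rewrite gt_eqF.
have -> : 1 - s / (s + b) = (s + b)^-1 * b by field.
rewrite [s / _]mulrC /w -!scalerA -scalerDr [s *: _]scalerA divff // scale1r.
move=> Ep; rewrite -/w -!mulrA -mulrDr ler_pdivrMl // => le_p; split=> //.
by apply: le_trans le_p; rewrite lerD2r.
Qed.

Lemma concave_jensen n (a : 'I_n -> R) (z : 'I_n -> V) :
  (forall t, 0 <= a t) -> \sum_t a t = 1 -> (forall t, E (z t)) ->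
  E (\sum_t a t *: z t) /\
  \sum_t a t * f (z t) <= f (\sum_t a t *: z t).
Proof.
move=> a0 a1 Ez; have := concave_weighted_sum a0 Ez.
by rewrite a1 invr1 scale1r mul1r => /(_ ltr01).
Qed.

End Jensen.

(** * Horn intersections and the concavity inequality *)

Section HornTuples.
Context {R : realType} {d r n : nat}.
Local Notation C := R[i].

(** The Horn condition covers all flags, in particular those moved by [A t] and [B]; pulling [L]
    back by the inverses undoes the move. *)
Lemma horn_tuple_mximage (I : 'I_n -> {set 'I_d}) (K : {set 'I_d})
    (F : 'I_n -> nat -> {vspace 'cV[C]_d}) (G : nat -> {vspace 'cV[C]_d})
    (A : 'I_n -> 'M[C]_d) (B : 'M[C]_d) :
  horn_tuple R r I K ->
  (forall t, complete_flag (F t)) -> complete_flag G ->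
  (forall t, A t \in unitmx) -> B \in unitmx ->
  exists L, [/\ \dim L = r,
    forall t, schubert r (dualset (I t)) (F t) (mximage (invmx (A t)) L) &
    schubert r K G (mximage (invmx B) L)].
Proof.
move=> [_ _ horn] cF cG Au Bu.
have [||L [LF LG]] :=
    horn (fun t k => mximage (A t) (F t k)) (fun k => mximage B (G k)).
- by move=> t; exact: complete_flag_mximage.
- exact: complete_flag_mximage.
exists L; split; first by case: LG.
- by move=> t; apply: (schubert_mximage (Au t)); exact: LF.
- exact: schubert_mximage LG.
Qed.

End HornTuples.

Section HornConcavity.
Context {R : realType} {d r : nat} {V : lmodType R}.
Variables (E : set V) (Z M : V -> 'M[R[i]]_d) (phi : 'rV[R]_r -> R).
Hypotheses (cE : convex_set E) (hM : forall x, E x -> M x \in unitmx).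
Hypothesis hTheta : forall L : {vspace 'cV[R[i]]_d}, \dim L = r ->
  concave_function E (ThetaL phi Z M L).

(** [W], [F] and [G] stay abstract so that both monotonicity cases are instances. *)
Lemma horn_concavity n (I : 'I_n -> {set 'I_d}) (K : {set 'I_d})
    (W : {set 'I_d} -> V -> R) (F G : V -> nat -> {vspace 'cV[R[i]]_d})
    (a : 'I_n -> R) (z : 'I_n -> V) :
  horn_tuple R r I K ->
  (forall x, E x -> complete_flag (F x)) ->
  (forall x, E x -> complete_flag (G x)) ->
  (forall t x L, E x -> schubert r (dualset (I t)) (F x) L ->
     W (I t) x <= Theta (Z x) phi L) ->
  (forall x L, E x -> schubert r K (G x) L -> Theta (Z x) phi L <= W K x) ->
  (forall t, 0 <= a t) -> \sum_t a t = 1 -> (forall t, E (z t)) ->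
  \sum_t a t * W (I t) (z t) <= W K (\sum_t a t *: z t).
Proof.
move=> horn cF cG WF WG a0 a1 Ez; set zb := \sum_t _ *: _.
have Ezb : E zb.
  (* Jensen for the zero function only asserts that [E] contains [zb]. *)
  have [|//] := concave_jensen cE (f := fun=> 0) _ a0 a1 Ez.
  by move=> t x y _ _; rewrite convRE oppr0 !mulr0 addr0.
have [L [dimL LF LG]] := horn_tuple_mximage (A := M \o z) horn
  (fun t => cF _ (Ez t)) (cG _ Ezb) (fun t => hM (Ez t)) (hM Ezb).
have [_ jensen] := concave_jensen cE (hTheta dimL) a0 a1 Ez.
apply: le_trans (WG _ _ Ezb LG); apply: le_trans jensen.
by apply: ler_sum => t _; rewrite ler_wpM2l //; exact: WF (LF t).
Qed.

End HornConcavity.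

Theorem proposition14 (R : realType) (d r : nat) (hr : (1 <= r <= d)%N)
    (V : lmodType R) (E : set V) (hE : convex_set E)
    (Z : V -> 'M[R[i]]_d) (hZ : forall z, E z -> Z z \is hermsymmx)
    (M : V -> 'M[R[i]]_d) (hM : forall z, E z -> M z \in unitmx)
    (phi : 'rV[R]_r -> R)
    (hTheta : forall L : {vspace 'cV[R[i]]_d}, \dim L = r ->
       concave_function E (ThetaL phi Z M L)) :
  (coord_nondecreasing phi ->
     forall (n : nat) (I : 'I_n -> {set 'I_d}) (K : {set 'I_d}),
       horn_tuple R r I K ->
     forall (alpha : 'I_n -> R) (z : 'I_n -> V),
       (forall t, 0 <= alpha t) -> \sum_(t < n) alpha t = 1 ->
       (forall t, E (z t)) ->
     Lambda phi Z K (\sum_(t < n) alpha t *: z t) >=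
       \sum_(t < n) alpha t * Lambda phi Z (I t) (z t))
  /\
  (coord_nonincreasing phi ->
     forall (n : nat) (I : 'I_n -> {set 'I_d}) (K : {set 'I_d}),
       horn_tuple R r I K ->
     forall (alpha : 'I_n -> R) (z : 'I_n -> V),
       (forall t, 0 <= alpha t) -> \sum_(t < n) alpha t = 1 ->
       (forall t, E (z t)) ->
     Lambda phi Z (dualset K) (\sum_(t < n) alpha t *: z t) >=
       \sum_(t < n) alpha t * Lambda phi Z (dualset (I t)) (z t)).
Proof.
(* One eigenflag is chosen for each point; outside [E] the value is a dummy. *)
have [x|Up UpP] :=
    @choice _ _ (fun x F => E x -> increasing_eigenflag (Z x) F).
  have [/hZ/exists_increasing_eigenflag[F FP]|nEx] := pselect (E x).
    by exists F.
  by exists (fun=> 0%VS).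
have [x|Down DownP] :=
    @choice _ _ (fun x F => E x -> decreasing_eigenflag (Z x) F).
  have [/hZ/exists_decreasing_eigenflag[F FP]|nEx] := pselect (E x).
    by exists F.
  by exists (fun=> 0%VS).
split=> phi_mono n I K horn alpha z; have [cI cK _] := horn.
- apply: (horn_concavity hE hM hTheta (W := Lambda phi Z)
    (F := Down) (G := Up)) => //.
  + by move=> x /DownP[].
  + by move=> x /UpP[].
  + move=> t x L Ex LF; apply: phi_mono => q; rewrite !mxE.
    exact: eig_up_compress_ge_schubert _ (hZ _ Ex) (cI t) (DownP x Ex) LF.
  + move=> x L Ex LG; apply: phi_mono => q; rewrite !mxE.
    exact: eig_up_compress_le_schubert _ (hZ _ Ex) cK (UpP x Ex) LG.
- apply: (horn_concavity hE hM hTheta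
    (W := fun J => Lambda phi Z (dualset J)) (F := Up) (G := Down)) => //.
  + by move=> x /UpP[].
  + by move=> x /DownP[].
  + move=> t x L Ex LF; apply: phi_mono => q; rewrite !mxE.
    apply: eig_up_compress_le_schubert _ (hZ _ Ex) _ (UpP x Ex) LF.
    by rewrite card_dualset.
  + move=> x L Ex LG; apply: phi_mono => q; rewrite !mxE.
    (* The lower bound is used for the index set [dualset K], whose own dual is [K]. *)
    apply: eig_up_compress_ge_schubert _ (hZ _ Ex) _ (DownP x Ex) _.
      by rewrite card_dualset.
    by rewrite dualsetK.
Qed.
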